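(* Let $Y$ be a set and let $\mathcal{L}$ be a $T_1$ sublattice of $2^Y$. Then: (1) If $Y$ is finite, then $\mathcal{L}$ is the closed subset lattice of the discrete topology on $Y$; that is, $\mathcal{L} = 2^Y$. (Hence $\Gamma(\mathcal{L})$ is the complement of the incidence graph on the proper nonempty subsets of $Y$, in which two distinct subsets are adjacent when they intersect.) (2) If $|Y| \leq 1$, then $\Gamma(\mathcal{L})$ is empty. (3) If $|Y| = 2$, then $\Gamma(\mathcal{L})$ consists of two vertices joined by one edge. Hence $\operatorname{diam} \Gamma(\mathcal{L}) = 1$ and $\operatorname{girth} \Gamma(\mathcal{L}) = \infty$. (4) If $|Y| \geq 3$ and $\mathcal{L}$ is irreducible, then $Y$ is infinite, $\operatorname{diam} \Gamma(\mathcal{L}) = 2$, and $\operatorname{girth} \Gamma(\mathcal{L}) = 3$. (5) If $|Y| \geq 3$ and $\mathcal{L}$ is not irreducible, then $\operatorname{diam} \Gamma(\mathcal{L}) = 3$ and $\operatorname{girth} \Gamma(\mathcal{L}) = 3$.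
   Context: A sublattice $\mathcal{L}$ of $2^Y$ means a bounded lattice of subsets of $Y$: a collection of subsets of $Y$ containing $\emptyset$ and $Y$ and closed under finite unions and finite intersections. It is $T_1$ if $\{y\}\in\mathcal{L}$ for all $y\in Y$. It is irreducible if for all $A,B\in\mathcal{L}\setminus\{Y\}$ we have $A\cup B\neq Y$. $\Gamma(\mathcal{L})$ denotes the zero-divisor graph of the semigroup $(\mathcal{L},\cap)$, whose absorbing element is $\emptyset$: its vertices are the nonempty $A\in\mathcal{L}$ such that $A\cap B=\emptyset$ for some nonempty $B\in\mathcal{L}$, and two distinct vertices $A,B$ are adjacent precisely when $A\cap B=\emptyset$. For a graph $G$: $\operatorname{diam} G$ is the supremum of the distances between pairs of vertices; $\operatorname{girth} G$ is the length of a shortest cycle, or $\infty$ if there are no cycles. *)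

(* Defs.v *)
From mathcomp Require Export all_boot all_order all_algebra.
From mathcomp Require Export boolp classical_sets cardinality.
From mathcomp Require Export reals ereal topology.

#[export] Set Implicit Arguments.
#[export] Unset Strict Implicit.
#[export] Unset Printing Implicit Defensive.

Local Open Scope classical_set_scope.

Record sublattice (Y : Type) (L : set (set Y)) : Prop := Sublattice {
  sublattice0 : L set0;
  sublatticeT : L [set: Y];
  sublatticeU : setU_closed L;
  sublatticeI : setI_closed L }.

Definition T1_lattice (Y : Type) (L : set (set Y)) : Prop :=
  forall y : Y, L [set y].

Definition irreducible_lattice (Y : Type) (L : set (set Y)) : Prop :=
  forall A B : set Y, L A -> L B -> A <> [set: Y] -> B <> [set: Y] ->
    A `|` B <> [set: Y].

(* {classic Y} is Y with the choiceType structure coming from the axiom of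
   choice, which the library requires of the points of a topological space. *)
Definition discrete_closed_sets (Y : Type) : set (set Y) :=
  [set A | closed (A : set (discrete_topology {classic Y}))].
Arguments discrete_closed_sets Y _ : clear implicits.

(* Adjacency is boolean so that path and ucycle apply to it. *)
Record sgraph (T : eqType) := SGraph {
  vertices : set T;
  adj : rel T;
  adj_sym : symmetric adj;
  adj_irr : irreflexive adj;
  adj_vertex : forall x y, adj x y -> vertices x }.

(* Distances, diameter and girth are extended reals, with inf of the empty set
   equal to +oo. A path x :: s has size s edges, and so has a cycle s. *)
Section Invariants.
Context (R : realType) (T : eqType) (G : sgraph T).
Local Open Scope ring_scope.
Local Open Scope ereal_scope.

Definition dist (x y : T) : \bar R :=
  ereal_inf [set (size s)%:R%:E | s in
    [set s : seq T | [/\ path (adj G) x s, uniq (x :: s) & last x s = y]]].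

Definition diam : \bar R :=
  ereal_sup [set dist x y | x in vertices G & y in vertices G].

Definition girth : \bar R :=
  ereal_inf [set (size s)%:R%:E | s in
    [set s : seq T | (3 <= size s)%N /\ ucycle (adj G) s]].

End Invariants.
Arguments dist R {T} G x y.
Arguments diam R {T} G.
Arguments girth R {T} G.

(* The simple graph on V whose edges join distinct x, y in V with e x y. *)
Section MkGraph.
Context (T : eqType) (V : set T) (e : T -> T -> Prop).
Context (e_sym : forall x y, e x y -> e y x).

Let a : rel T := fun x y => `[< [/\ V x, V y, x <> y & e x y] >].

Let a_sym : symmetric a.
Proof.
move=> x y; apply: asbool_equiv_eq.
by split=> -[Vx Vy xy exy]; split=> //; [exact: nesym | exact: e_sym
                                        |exact: nesym | exact: e_sym].
Qed.

Let a_irr : irreflexive a.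
Proof. by move=> x; apply/asboolPn => -[]. Qed.

Let a_vertex x y : a x y -> V x.
Proof. by move=> /asboolP[]. Qed.

Definition mkgraph : sgraph T := SGraph a_sym a_irr a_vertex.
End MkGraph.

Lemma nadj_sym (T : eqType) (G : sgraph T) (x y : T) :
  ~~ adj G x y -> ~~ adj G y x.
Proof. by rewrite adj_sym. Qed.

Definition complement_graph (T : eqType) (G : sgraph T) : sgraph T :=
  mkgraph (vertices G) (@nadj_sym T G).

Lemma disjoint_sym (Y : Type) (A B : set Y) :
  A `&` B = set0 -> B `&` A = set0.
Proof. by rewrite setIC. Qed.

Lemma meet_sym (Y : Type) (A B : set Y) : A `&` B !=set0 -> B `&` A !=set0.
Proof. by rewrite setIC. Qed.

Definition zero_divisor_graph (Y : Type) (L : set (set Y)) : sgraph (set Y) :=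
  mkgraph
    [set A | [/\ L A, A !=set0 &
                 exists B, [/\ L B, B !=set0 & A `&` B = set0]]]
    (@disjoint_sym Y).

Definition incidence_graph (Y : Type) : sgraph (set Y) :=
  mkgraph [set A | A !=set0 /\ A <> [set: Y]] (@meet_sym Y).

(* Main.v *)
Require Import Defs.
From mathcomp Require Import functions.
Import Order.TTheory GRing.Theory Num.Theory.
Local Open Scope classical_set_scope.
Local Open Scope card_scope.
Local Open Scope ereal_scope.

(** Write Gamma for the zero-divisor graph of L. Everything rests on the
    singletons being available in L. A nonempty A in L is a vertex of Gamma as
    soon as it misses one point y, because [set y] is then disjoint from A
    (zdg_vertexP); so the vertices are the nonempty proper members of L, each
    vertex A is adjacent to [set y] for any y outside A, and the singletons of
    any three points form a triangle.

    If Y is finite, every subset is a finite union of singletons, so L is the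
    whole power set. If Y has at most one point there is no nonempty proper
    subset, and if Y = {a, b} the only ones are {a} and {b}.

    Let Y have at least three points. The girth is 3 by the triangle. For the
    diameter, two vertices A and B have a common neighbour exactly when their
    union is not Y: a point outside the union gives one, and a nonempty set
    disjoint from both prevents them from covering Y.

    - If L is irreducible no two vertices cover Y, so the diameter is at most 2;
      it is 2 because {x} and {x, y} meet and are distinct (zdg_diam2). Moreover
      Y is infinite, since a finite Y would be covered by {x} and its
      complement.
    - In general, choosing a outside A and b outside B gives the walk
      A - {a} - {b} - B, so the diameter is at most 3. If L is not irreducible,
      some two proper members of L cover Y, and with a third point at hand they
      can be made to overlap (overlapping_cover). They are then neither adjacent
      nor joined through a common neighbour, so their distance is 3
      (zdg_diam3). *)

(** * Distance, diameter and girth of graphs *)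

Lemma sgraph_ext (T : eqType) (G H : sgraph T) :
  vertices G = vertices H -> adj G =2 adj H -> G = H.
Proof.
case: G H => [V a s i v] [W b s' i' v'] /= VW ab; subst W.
have {}ab : a = b by apply/funext => x; apply/funext => y.
by subst b; congr SGraph; exact: Prop_irrelevance.
Qed.

Section GraphInvariants.
Context (R : realType) (T : eqType) (G : sgraph T).

(** A walk may repeat vertices, whereas the distance is over simple paths:
    removing the loops of a walk only shortens it. Upper bounds on distances can
    thus be given by walks, without checking that their vertices differ. *)
Lemma dist_le_walk (x y : T) (s : seq T) :
  path (adj G) x s -> last x s = y -> dist R G x y <= (size s)%:R%:E.
Proof.
move=> Gs <-; case: (shortenP Gs) => p Gp up ps.
apply: ge_ereal_inf; exists (size p)%:R%:E; first by exists p.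
rewrite lee_fin ler_nat; apply: uniq_leq_size => //.
by move: up => /= /andP[].
Qed.

Lemma dist_ge_walk (x y : T) (n : nat) :
  (forall s, path (adj G) x s -> last x s = y -> (n <= size s)%N) ->
  n%:R%:E <= dist R G x y.
Proof.
move=> ns; apply/ereal_infP => _ [s [Gs _ xy] <-].
by rewrite lee_fin ler_nat; exact: ns.
Qed.

Lemma diam_eq (n : nat) :
  (forall x y, vertices G x -> vertices G y ->
     exists s, [/\ path (adj G) x s, last x s = y & (size s <= n)%N]) ->
  (exists x y, [/\ vertices G x, vertices G y & forall s,
     path (adj G) x s -> last x s = y -> (n <= size s)%N]) ->
  diam R G = n%:R%:E.
Proof.
move=> ub [x [y [Vx Vy lb]]]; apply/eqP; rewrite eq_le; apply/andP; split.
  apply/ereal_supP => _ [z Vz [t Vt <-]].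
  have [s [Gs st sn]] := ub z t Vz Vt.
  by apply: (le_trans (dist_le_walk Gs st)); rewrite lee_fin ler_nat.
apply: le_ereal_sup_tmp; exists (dist R G x y); last exact: dist_ge_walk.
by exists x => //; exists y.
Qed.

Lemma walk_ge2 (x y : T) (s : seq T) : x <> y -> ~~ adj G x y ->
  path (adj G) x s -> last x s = y -> (2 <= size s)%N.
Proof. by case: s => [|z [|t s]] //= + + /andP[+ _] zy; rewrite zy => _ /negP. Qed.

(** A walk with one inner vertex exhibits a common neighbour of its ends. *)
Lemma walk_ge3 (x y : T) (s : seq T) : x <> y -> ~~ adj G x y ->
  (forall z, ~~ (adj G x z && adj G z y)) ->
  path (adj G) x s -> last x s = y -> (3 <= size s)%N.
Proof.
move=> xy nxy nz Gs sy; have := walk_ge2 xy nxy Gs sy.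
case: s Gs sy => [|z [|t [|u s]]] //= /and3P[xz zt _] ty _.
by have := nz z; rewrite xz -ty zt.
Qed.

Lemma girth_triangle (x y z : T) :
  adj G x y -> adj G y z -> adj G z x -> girth R G = 3%:E.
Proof.
have adj_neq u v : adj G u v -> u != v.
  by move=> uv; apply/eqP => uv'; rewrite uv' adj_irr in uv.
move=> xy yz zx; apply/eqP; rewrite eq_le; apply/andP; split.
  apply: ge_ereal_inf; exists 3%:R%:E => //; exists [:: x; y; z] => //.
  split=> //; rewrite /ucycle /= xy yz zx !inE !negb_or.
  by rewrite (adj_neq x y)// (adj_neq y z)// eq_sym (adj_neq z x).
by apply/ereal_infP => _ [s [s3 _] <-]; rewrite lee_fin ler_nat.
Qed.

(** The vertices of a cycle are distinct and each of them has a neighbour, so a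
    cycle needs at least three vertices in the graph. *)
Lemma girth_two_vertices (x y : T) :
  vertices G `<=` [set x; y] -> girth R G = +oo.
Proof.
move=> Vxy; rewrite /girth.
suff -> : [set s : seq T | (3 <= size s)%N /\ ucycle (adj G) s] = set0.
  by rewrite image_set0 ereal_inf0.
rewrite -subset0 => s [s3 /andP[Gs us]].
suff /(uniq_leq_size us) : {subset s <= [:: x; y]} by rewrite leqNgt s3.
move=> z /(next_cycle Gs)/adj_vertex/Vxy.
by move=> [|] ->; rewrite !inE eqxx ?orbT.
Qed.

End GraphInvariants.

(** * Types with few or with several points *)

Lemma three_points (Y : Type) : `I_3 #<= [set: Y] ->
  exists x y z : Y, [/\ x <> y, y <> z & z <> x].
Proof.
move=> /pfcard_geP[I0|[f]]; first by have : `I_3 0%N by []; rewrite I0.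
have pt k : `I_3 k -> exists y, f y = k.
  by move=> /(@surj _ _ _ _ f)[y _ <-]; exists y.
have [[x fx] [y fy] [z fz]] := And3 (pt 0%N isT) (pt 1%N isT) (pt 2%N isT).
by exists x, y, z; split=> /(congr1 f); rewrite ?fx ?fy ?fz.
Qed.

Lemma two_points (Y : Type) : [set: Y] #= `I_2 ->
  exists a b : Y, a <> b /\ forall y, y = a \/ y = b.
Proof.
move=> /card_set_bijP[f [fI finj fsurj]].
have [[a _ fa] [b _ fb]] := (fsurj 0%N isT, fsurj 1%N isT).
exists a, b; split=> [ab|y]; first by move: fa; rewrite ab fb.
have /= := fI y I.
have [] := (finj y a (mem_setT _) (mem_setT _), finj y b (mem_setT _) (mem_setT _)).
rewrite fa fb; case: (f y) => [|[|//]] ya yb _; [left|right]; auto.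
Qed.

(** * The zero-divisor graph of a T1 lattice *)

(* Keeps adjacency folded when paths are simplified. *)
Arguments adj : simpl never.

Section ZeroDivisorGraph.
Context (Y : Type) (L : set (set Y)).
Hypotheses (HL : sublattice L) (HT1 : T1_lattice L).
Local Notation Gam := (zero_divisor_graph L).

(** The nonempty member disjoint from a proper A can be taken to be the
    singleton of a missed point; this is where T1 enters. *)
Lemma zdg_vertexP (A : set Y) :
  vertices Gam A <-> [/\ L A, A !=set0 & A <> [set: Y]].
Proof.
split=> [[LA A0 [B [LB [y By] AB]]]|[LA A0 AT]]; split=> //.
  by move=> AT; rewrite -[False]/(@set0 Y y) -AB AT setTI.
have [y Ay] : exists y, ~ A y.
  by apply/existsNP => AY; apply: AT; apply/seteqP; split.
exists [set y]; split; [exact: HT1|by exists y|].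
by rewrite -subset0 => z [Az zy]; apply: Ay; rewrite -zy.
Qed.

(** Disjoint nonempty members of L are automatically distinct, and each
    witnesses that the other is a vertex. *)
Lemma zdg_adjP (A B : set Y) :
  adj Gam A B <->
  [/\ L A, L B, A !=set0, B !=set0 & A `&` B = set0].
Proof.
split=> [/asboolP[[LA A0 _] [LB B0 _] _ AB]//|[LA LB A0 B0 AB]].
apply/asboolP; split=> //; last by move=> E; case: B0 => y; rewrite -(setIid B) -{1}E AB.
- by split=> //; exists B.
- by split=> //; exists A; rewrite setIC.
Qed.

Lemma zdg_vertex_missing (A : set Y) :
  vertices Gam A -> exists y, ~ A y.
Proof.
move=> /zdg_vertexP[_ _ AT].
by apply/existsNP => AY; apply: AT; apply/seteqP; split.
Qed.

Lemma zdg_adj_set1 (A : set Y) (y : Y) :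
  vertices Gam A -> ~ A y -> adj Gam A [set y].
Proof.
move=> /zdg_vertexP[LA A0 _] Ay; apply/zdg_adjP; split=> //.
  by exists y.
by rewrite -subset0 => z [Az zy]; apply: Ay; rewrite -zy.
Qed.

Lemma zdg_adj_set11 (x y : Y) : x <> y -> adj Gam [set x] [set y].
Proof.
move=> xy; apply/zdg_adjP; split; [exact: HT1|exact: HT1|by exists x|by exists y|].
by rewrite -subset0 => z [/= -> /xy].
Qed.

(** A finite set is a finite union of singletons. *)
Lemma T1_finite (A : set Y) : finite_set A -> L A.
Proof.
move=> fA; have /finite_seqP[s] : finite_set (A : set {classic Y}) by [].
elim: s A {fA} => [|y s IH] A ->; first by rewrite set_nil; exact: sublattice0.
have -> : [set` y :: s] = [set y] `|` [set` s].
  by apply/seteqP; split=> z /=; rewrite inE => /predU1P.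
apply: (sublatticeU HL); [exact: HT1|exact: IH].
Qed.

Lemma T1_finiteT : finite_set [set: Y] -> L = [set: set Y].
Proof.
by move=> fY; apply/seteqP; split=> // A _; apply/T1_finite/(sub_finite_set _ fY).
Qed.

Lemma zdg_setT : L = [set: set Y] ->
  zero_divisor_graph L = complement_graph (incidence_graph Y).
Proof.
move=> LT.
have VE : vertices Gam = vertices (incidence_graph Y).
  by apply/seteqP; split=> A; rewrite zdg_vertexP LT => -[]; split.
apply: sgraph_ext => // A B; apply: asbool_equiv_eq.
rewrite -[X in X A]/(vertices Gam) -[X in X B]/(vertices Gam) VE.
split=> -[VA VB AB e]; split=> //.
  by apply/asboolPn => -[_ _ _ [y]]; rewrite e.
by rewrite -subset0 => y ABy; move/asboolPn: e; apply; split=> //; exists y.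
Qed.

Lemma zdg_le1 : [set: Y] #<= `I_1 -> vertices Gam = set0.
Proof.
move=> /pcard_leP[f]; rewrite -subset0 => A VA.
have [y Ay] := zdg_vertex_missing VA.
case: VA => _ [x Ax] _; apply: Ay; suff -> : y = x by [].
apply: (@inj _ _ _ f); rewrite ?in_setT//.
have := @funS _ _ _ _ f y I; have := @funS _ _ _ _ f x I => /=.
by case: (f x) (f y) => // -[].
Qed.

(** A vertex contains one of the two points and misses the other. *)
Lemma zdg_two_vertices (a b : Y) : a <> b -> (forall y, y = a \/ y = b) ->
  vertices Gam = [set [set a]; [set b]].
Proof.
move=> ab Yab; apply/seteqP; split=> [A VA|A].
  have [y Ay] := zdg_vertex_missing VA; case: VA => _ [x Ax] _.
  have xy : x <> y by move=> xy; apply: Ay; rewrite -xy.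
  suff AE : A = [set x] by case: (Yab x) => <-; [left|right].
  apply/seteqP; split=> z; last by move=> ->.
  move=> Az /=; have : z <> y by move=> zy; apply: Ay; rewrite -zy.
  by have [] := (Yab x, Yab y); have := Yab z; intuition congruence.
move=> [|] ->; apply: adj_vertex; apply: zdg_adj_set11; [exact: ab|exact: nesym ab].
Qed.

Lemma zdg_girth3 (R : realType) (x y z : Y) :
  x <> y -> y <> z -> z <> x -> girth R Gam = 3%:E.
Proof.
move=> xy yz zx.
exact: girth_triangle (zdg_adj_set11 xy) (zdg_adj_set11 yz) (zdg_adj_set11 zx).
Qed.

Lemma zdg_diam1 (R : realType) (a b : Y) :
  a <> b -> (forall y, y = a \/ y = b) -> diam R Gam = 1%:E.
Proof.
move=> ab Yab; have VE := zdg_two_vertices ab Yab.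
have Gab := zdg_adj_set11 ab; have Gba := zdg_adj_set11 (nesym ab).
apply: (@diam_eq R _ Gam 1).
  rewrite VE => A B [|] -> [|] ->;
    by [exists [::] | exists [:: [set a]]; rewrite /= Gba
                    | exists [:: [set b]]; rewrite /= Gab].
exists [set a], [set b]; split; [by rewrite VE; left|by rewrite VE; right|].
by move=> [|//] _ /= E; move: Gab; rewrite E adj_irr.
Qed.

(** In a finite Y the complement of {x} also lies in L, and together with {x}
    it covers Y. *)
Lemma T1_irreducible_infinite (x y : Y) :
  x <> y -> irreducible_lattice L -> infinite_set [set: Y].
Proof.
move=> xy Lirr fY; have LT := T1_finiteT fY.
apply: (Lirr [set x] (~` [set x])); rewrite ?LT ?setUv//.
- by move=> /seteqP[_ /(_ y I)] /nesym.
- by move=> /seteqP[_ /(_ x I)]; apply.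
Qed.

(** A union of two vertices is again a proper member of L by irreducibility, so
    it misses a point w, and [set w] is a common neighbour. The distance 2 is
    attained at {x} and {x, y}, where z makes {x, y} a vertex. *)
Lemma zdg_diam2 (R : realType) (x y z : Y) :
  x <> y -> y <> z -> z <> x -> irreducible_lattice L -> diam R Gam = 2%:E.
Proof.
move=> xy yz zx Lirr; apply: (@diam_eq R _ Gam 2).
  move=> A B VA VB.
  have [[LA A0 AT] [LB _ BT]] := ((zdg_vertexP A).1 VA, (zdg_vertexP B).1 VB).
  have VAB : vertices Gam (A `|` B).
    apply/zdg_vertexP; split; [exact: (sublatticeU HL)| |exact: Lirr].
    by case: A0 => a Aa; exists a; left.
  have [w /not_orP[Aw Bw]] := zdg_vertex_missing VAB.
  exists [:: [set w]; B]; split=> //=.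
  by rewrite (zdg_adj_set1 VA Aw) adj_sym (zdg_adj_set1 VB Bw).
have Vx : vertices Gam [set x] := adj_vertex (zdg_adj_set11 xy).
have Vxy : vertices Gam ([set x] `|` [set y]).
  apply/zdg_vertexP; split; [exact: (sublatticeU HL)|by exists x; left|].
  by move=> /seteqP[_ /(_ z I)] [/zx|/(nesym yz)].
exists [set x], ([set x] `|` [set y]); split=> // s; apply: walk_ge2.
  by move=> /seteqP[_ /(_ y)] => /(_ (or_intror erefl))/(nesym xy).
apply/negP => /zdg_adjP[_ _ _ _]; rewrite -subset0 => /(_ x); apply.
by split=> //; left.
Qed.

Lemma reducible_cover : ~ irreducible_lattice L ->
  exists A B, [/\ L A, L B, A <> [set: Y], B <> [set: Y] &
                  A `|` B = [set: Y]].
Proof.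
move=> Lred; apply: contrapT => H; apply: Lred => A B LA LB AT BT AB.
by apply: H; exists A, B.
Qed.

(** A disjoint cover becomes an overlapping one when a point p of the first
    part is added to the second; a further point q of the first part keeps the
    enlarged second part proper. *)
Lemma split_cover (A B : set Y) (p q : Y) :
  L A -> L B -> A `|` B = [set: Y] -> A `&` B = set0 -> A <> [set: Y] ->
  p <> q -> A p -> A q ->
  exists C D, [/\ vertices Gam C, vertices Gam D, C `|` D = [set: Y] &
                  C `&` D !=set0].
Proof.
move=> LA LB ABT AB0 AT pq Ap Aq; exists A, (B `|` [set p]); split.
- by apply/zdg_vertexP; split=> //; exists p.
- apply/zdg_vertexP; split.
  + by apply: (sublatticeU HL) => //; exact: HT1.
  + by exists p; right.
  + move=> /seteqP[_ /(_ q I)] [Bq|/(nesym pq)//].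
    by rewrite -[False]/(@set0 Y q) -AB0.
- by rewrite setUA ABT setTU.
- by exists p; split=> //; right.
Qed.

(** Of three points, two lie in the same part of a cover by two sets, so that a
    disjoint cover always has a part that split_cover can work with. *)
Lemma overlapping_cover (x y z : Y) :
  x <> y -> y <> z -> z <> x -> ~ irreducible_lattice L ->
  exists C D, [/\ vertices Gam C, vertices Gam D, C `|` D = [set: Y] &
                  C `&` D !=set0].
Proof.
move=> xy yz zx /reducible_cover[A [B [LA LB AT BT ABT]]].
have [AB0|/set0P AB0] := eqVneq (A `&` B) set0; last first.
  exists A, B; split=> //; apply/zdg_vertexP; split=> //.
    by case: AB0 => w [Aw _]; exists w.
  by case: AB0 => w [_ Bw]; exists w.
have inA p q := @split_cover A B p q LA LB ABT AB0 AT.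
rewrite setUC in ABT; rewrite setIC in AB0.
have inB p q := @split_cover B A p q LB LA ABT AB0 BT.
have AorB w : B w \/ A w by have : [set: Y] w by []; rewrite -ABT.
case: (AorB x) (AorB y) (AorB z) => [Bx|Ax] [By|Ay] [Bz|Az].
(* Pigeonhole: whichever parts the points lie in, two of them share one. *)
all: by [exact: (inA x y)|exact: (inB x y)|exact: (inA y z)|exact: (inB y z)
        |exact: (inA z x)|exact: (inB z x)].
Qed.

(** The bound comes from the walk A - {a} - {b} - B with a and b missed by A and
    B. It is attained at two vertices that meet and cover Y: a common neighbour
    would be a nonempty set disjoint from all of Y. *)
Lemma zdg_diam3 (R : realType) (x y z : Y) :
  x <> y -> y <> z -> z <> x -> ~ irreducible_lattice L -> diam R Gam = 3%:E.
Proof.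
move=> xy yz zx Lred; apply: (@diam_eq R _ Gam 3).
  move=> A B VA VB.
  have [[a Aa] [b Bb]] := (zdg_vertex_missing VA, zdg_vertex_missing VB).
  have Ga := zdg_adj_set1 VA Aa; have Gb := zdg_adj_set1 VB Bb.
  (* When a = b the two inner vertices coincide and the walk has length 2. *)
  have [ab|ab] := pselect (a = b).
    by exists [:: [set a]; B]; rewrite /= Ga ab adj_sym Gb.
  by exists [:: [set a]; [set b]; B]; rewrite /= Ga (zdg_adj_set11 ab) adj_sym Gb.
have [C [D [VC VD CDT [w CDw]]]] := overlapping_cover xy yz zx Lred.
exists C, D; split=> // s; apply: walk_ge3.
- move=> CD; have [v Cv] := zdg_vertex_missing VC.
  by apply: Cv; have : [set: Y] v by []; rewrite -CDT -CD setUid.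
- by apply/negP => /zdg_adjP[_ _ _ _ CD0]; rewrite CD0 in CDw.
- move=> N; apply/negP => /andP[/zdg_adjP[_ _ _ [v Nv] CN] /zdg_adjP[_ _ _ _ ND]].
  have : [set: Y] v by []; rewrite -CDT => -[Cv|Dv].
    by rewrite -[False]/(@set0 Y v) -CN.
  by rewrite -[False]/(@set0 Y v) -ND.
Qed.

End ZeroDivisorGraph.

Theorem theorem5p3 (R : realType) (Y : Type) (L : set (set Y))
    (HL : sublattice L) (HT1 : T1_lattice L) :
  (* (1) *)
  (finite_set [set: Y] ->
     [/\ L = discrete_closed_sets Y, L = [set: set Y] &
         zero_divisor_graph L = complement_graph (incidence_graph Y)]) /\
  (* (2) *)
  ([set: Y] #<= `I_1 -> vertices (zero_divisor_graph L) = set0) /\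
  (* (3) *)
  ([set: Y] #= `I_2 ->
     [/\ exists A B : set Y,
           [/\ A <> B, vertices (zero_divisor_graph L) = [set A; B] &
               adj (zero_divisor_graph L) A B],
         diam R (zero_divisor_graph L) = 1%:E &
         girth R (zero_divisor_graph L) = +oo]) /\
  (* (4) *)
  (`I_3 #<= [set: Y] -> irreducible_lattice L ->
     [/\ infinite_set [set: Y],
         diam R (zero_divisor_graph L) = 2%:E &
         girth R (zero_divisor_graph L) = 3%:E]) /\
  (* (5) *)
  (`I_3 #<= [set: Y] -> ~ irreducible_lattice L ->
     diam R (zero_divisor_graph L) = 3%:E /\
     girth R (zero_divisor_graph L) = 3%:E).
Proof.
split=> [fY|].
  have LT := T1_finiteT HL HT1 fY; split=> //; last exact: zdg_setT.
  by rewrite LT; apply/seteqP; split=> // A _; exact: discrete_closed.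
split; first exact: zdg_le1.
split=> [/two_points[a [b [ab Yab]]]|].
  have VE := zdg_two_vertices HT1 ab Yab; have Gab := zdg_adj_set11 HT1 ab.
  split; [exists [set a], [set b]|exact: zdg_diam1 ab Yab|].
    by split=> // E; move: Gab; rewrite E adj_irr.
  by apply: (@girth_two_vertices _ _ _ [set a] [set b]); rewrite VE.
split=> /three_points[x [y [z [xy yz zx]]]].
  move=> Lirr; split; [exact: T1_irreducible_infinite xy Lirr| |].
    exact: zdg_diam2 xy yz zx Lirr.
  exact: zdg_girth3 xy yz zx.
move=> Lred; split; first exact: zdg_diam3 xy yz zx Lred.
exact: zdg_girth3 xy yz zx.
Qed.
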